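(* Let $x_1,\ldots,x_n$ ($n\ge2$) be independent random variables with common mean $\mu_x$ and $|x_i-\mu_x|\le C_x$ for a constant $C_x$. Let $s_n=\sum_{i=1}^n x_i$ and let $\hat s_n$ be computed by recursive summation: $\hat s_1=x_1$, $\hat s_k=(\hat s_{k-1}+x_k)(1+\delta_k)$ for $2\le k\le n$, and $E_n=\hat s_n-s_n$. Assume the rounding errors $\delta_2,\ldots,\delta_n$ are random variables of mean zero such that for every $k$, \[ \mathbb{E}(\delta_k\mid \delta_2,\ldots,\delta_{k-1},x_1,\ldots,x_n)=0, \] and $a_k\le\delta_k\le b_k$, where $a_k,b_k$ are functions of $\delta_1,\ldots,\delta_{k-1}$ and $x_1,\ldots,x_n$ with $b_k-a_k\le 2u$ for a constant $u>0$ (and $\delta_1=0$). Then for any $\delta\in(0,1)$, with probability at least $1-\delta$, \[ |E_n|\le \Bigl(\sum_{j=0}^{n-2}\kappa^j\Bigr)\bigl(\lambda|\mu_x|n^{3/2}+\lambda^2C_x n\bigr)u \;=\;\frac{1-\kappa^{n-1}}{1-\kappa}\bigl(\lambda|\mu_x|n^{3/2}+\lambda^2C_x n\bigr)u\quad(\kappa\ne1), \] where $\lambda=\sqrt{2\log(2n/\delta)}$ and $\kappa=\lambda\sqrt{n}\,u$.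
   Context: The recurrence models recursive summation in floating-point arithmetic with unit roundoff $u$ (including stochastic rounding); $\delta_k$ is the relative rounding error at step $k$. *)

(* Defs.v *)
From HB Require Import structures.
From mathcomp Require Import all_boot all_order all_algebra.
From mathcomp Require Import all_classical all_reals all_analysis.
Set Implicit Arguments. Unset Strict Implicit. Unset Printing Implicit Defensive.
Import Order.TTheory GRing.Theory Num.Theory.
Local Open Scope classical_set_scope.
Local Open Scope ring_scope.

(* Recursive summation: shat 1 = x 1, shat k = (shat (k-1) + x k)(1 + d k), k >= 2.
   (shat 0 = 0 is an unused dummy value.) *)
Fixpoint rsum {T : Type} {R : ringType} (x d : nat -> T -> R) (k : nat) (w : T) : R :=
  match k with
  | 0 => 0
  | k'.+1 => if k' == 0%N then x 1%N w
             else (rsum x d k' w + x k'.+1 w) * (1 + d k'.+1 w)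
  end.

Definition esum_n {T : Type} {R : ringType} (x : nat -> T -> R) (k : nat) (w : T) : R :=
  \sum_(1 <= i < k.+1) x i w.

Definition preims {T : Type} {R : realType} (f : nat -> T -> R) (I : set nat)
  : set (set T) :=
  [set A | exists i, I i /\ exists B : set R, measurable B /\ A = f i @^-1` B].

Definition info {T : Type} {R : realType} (x d : nat -> T -> R) (n k : nat)
  : set (set T) :=
  <<s preims x [set i | (1 <= i <= n)%N] `|` preims d [set j | (2 <= j < k)%N] >>.

Definition measurable_wrt {T : Type} {R : realType} (G : set (set T)) (g : T -> R) :=
  forall B : set R, measurable B -> G (g @^-1` B).

Definition mutually_independent {d} {T : measurableType d} {R : realType}
  (P : probability T R) (x : nat -> T -> R) (n : nat) :=
  forall B : nat -> set R, (forall i, measurable (B i)) ->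
    P (\bigcap_(i in [set i | (1 <= i <= n)%N]) (x i @^-1` B i)) =
    (\prod_(1 <= i < n.+1) P (x i @^-1` B i))%E.

Definition condexp_zero {d} {T : measurableType d} {R : realType}
  (P : probability T R) (G : set (set T)) (g : T -> R) :=
  P.-integrable setT (fun w => (g w)%:E) /\
  forall A, G A -> (\int[P]_(w in A) (g w)%:E = 0)%E.

(* Main.v *)
Require Import Defs.
From HB Require Import structures.
From mathcomp Require Import all_boot all_order all_algebra.
From mathcomp Require Import all_classical all_reals all_analysis.
From mathcomp Require Import measurable_realfun ring lra.
Import Order.TTheory GRing.Theory Num.Theory.
Import numFieldNormedType.Exports.
Local Open Scope classical_set_scope.
Local Open Scope ring_scope.
Set Implicit Arguments.
Unset Strict Implicit.

(* The error satisfies E_k = sum_(2 <= j <= k) (shat_(j-1) + x_j) delta_j, a      *)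
(* martingale whose coefficients shat_(j-1) + x_j = s_j + E_(j-1) are predictable. *)
(* By Azuma's inequality for the stopped walk, outside an event of probability     *)
(* eps / n every |s_j| is at most Q = n |mu| + lam sqrt(n) Cx. If |E_j| <= B_j     *)
(* for j < k, the coefficients up to k are at most Q + B_(k-1), and Azuma's        *)
(* inequality for the sum with truncated coefficients gives                        *)
(* |E_k| <= B_k := lam sqrt(n) u (Q + B_(k-1)) outside a further event of          *)
(* probability eps / n. There are n such events in total, and solving the          *)
(* recursion for B_n yields the geometric sum.                                     *)

(** The analytic core is a martingale form of Hoeffding's lemma. If [e] is conditionally centered
    and lies in a predictable interval [[a, a + 2u]] containing 0, convexity bounds [expR (s * e)]
    by a constant plus a predictable multiple of [e] ([hoeffding_chord]), and that multiple
    integrates to 0 ([condexp_zeroM]). Iterating gives the sub-Gaussian bound [azuma_mgf], and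
    Chernoff's method turns it into [azuma_tail].

    This is used twice. For the centered data [x i - mu], independence supplies the conditional
    centering ([indep_condexp_zero]), and stopping ([azuma_max]) controls all partial sums by a
    single event. For the rounding errors, the coefficients are random and their size depends on
    earlier errors, so they are truncated ([azuma_truncated]); no circularity arises, because the
    bound on the coefficients up to step [k] involves only errors before step [k]. The rest is
    deterministic: [rsum_error_le] propagates the bounds, and a union bound over [n] events of
    probability at most [eps / n] concludes. *)

Lemma ge0_is_derive_le (R : realType) (f f' : R -> R) (h : R) :
  (forall x : R, is_derive x (1 : R) f (f' x)) -> (forall x, 0 <= x -> 0 <= f' x) ->
  0 <= h -> f 0 <= f h.
Proof.
move=> df f'0 h0; apply: (@ger0_derive1_ndecry R f 0) => //.
- move=> x; rewrite in_itv/= andbT => x0.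
  by rewrite derive1E; have H := df x; rewrite derive_val; exact/f'0/ltW.
- apply: continuous_subspaceT => x; apply: differentiable_continuous.
  by apply/derivable1_diffP; have H := df x; exact: ex_derive.
Qed.

(** Take logarithms: [g] is the right exponent minus the left one. Both [g] and its derivative [g1]
    vanish at 0, and the second derivative is [1/4 - q (1 - q) >= 0], where [q] is the exponentially
    tilted probability. Two integrations from 0 give [g >= 0]. *)
Lemma bernoulli_mgf_ge0 (R : realType) (p h : R) : 0 <= p <= 1 -> 0 <= h ->
  (1 - p) * expR (- (p * h)) + p * expR ((1 - p) * h) <= expR (h ^+ 2 / 8).
Proof.
move=> /andP[p0 p1] h0.
pose D x : R := 1 - p + p * expR x.
have D0 x : 0 < D x.
  have := expR_gt0 x; rewrite /D => e0.
  have [->|pn1] := eqVneq p 1; first by lra.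
  have : p < 1 by rewrite lt_neqAle pn1.
  have : 0 <= p * expR x by rewrite mulr_ge0// ltW.
  by lra.
have dD (x : R) : is_derive x (1 : R) D (p * expR x).
  by apply: is_derive_eq; rewrite /GRing.scale/=; lra.
pose q x : R := p * expR x / D x.
have dq (x : R) : is_derive x (1 : R) q (q x * (1 - q x)).
  have Dn0 : D x != 0 by rewrite gt_eqF.
  have dV := @is_deriveV _ _ _ _ _ Dn0 (dD x).
  rewrite /q; apply: is_derive_eq.
  rewrite /GRing.scale /= /q.
  field.
  exact: Dn0.
pose g1 (x : R) : R := x / 4 + p - q x.
have g1_ge0 x : 0 <= x -> 0 <= g1 x.
  move=> x0; have -> : 0 = g1 0.
    by rewrite /g1 /q /D expR0; rewrite mulr1 subrK divr1 mul0r add0r subrr.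
  apply: (@ge0_is_derive_le R g1 (fun x => 4^-1 - q x * (1 - q x))) => //.
    move=> y; rewrite /g1; apply: is_derive_eq.
    by rewrite /GRing.scale/=; lra.
  move=> y _; have := sqr_ge0 (q y - 2^-1); rewrite expr2; lra.
pose l : R -> R := (@ln R) \o D.
pose g (x : R) : R := x ^+ 2 / 8 + p * x - l x.
have dg (x : R) : is_derive x (1 : R) g (g1 x).
  have dl : is_derive x (1 : R) l ((D x)^-1 * (p * expR x)).
    exact: is_derive1_comp (is_derive1_ln (D0 x)) (dD x).
  rewrite /g; apply: is_derive_eq.
  by rewrite /GRing.scale/= /g1/q; lra.
have g0 : g 0 = 0 by rewrite /g /l/= /D expR0 mulr1 subrK ln1 expr0n/=; lra.
have : 0 <= g h by rewrite -g0; exact: ge0_is_derive_le dg g1_ge0 h0.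
rewrite /g /l /= => gh.
have -> : (1 - p) * expR (- (p * h)) + p * expR ((1 - p) * h)
    = expR (- (p * h)) * D h.
  rewrite /D mulrDr mulrC; congr (_ + _).
  by rewrite mulrCA -expRD; congr (_ * expR _); ring.
rewrite -[D h]lnK ?posrE// -expRD ler_expR; lra.
Qed.

Lemma bernoulli_mgf (R : realType) (p h : R) : 0 <= p <= 1 ->
  (1 - p) * expR (- (p * h)) + p * expR ((1 - p) * h) <= expR (h ^+ 2 / 8).
Proof.
move=> p01; have [h0|/ltW h0] := leP 0 h; first exact: bernoulli_mgf_ge0.
have /andP[p0 p1] := p01.
have q01 : 0 <= 1 - p <= 1 by apply/andP; split; lra.
have Nh : 0 <= - h by rewrite oppr_ge0.
have := @bernoulli_mgf_ge0 R (1 - p) (- h) q01 Nh.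
have -> : 1 - (1 - p) = p by lra.
by rewrite sqrrN [X in X <= _]addrC !mulrN opprK.
Qed.

(* Chord bound for the convex function expR (s * _) on [a, a + 2u]; the slope *)
(* only depends on a and s, so it is killed by conditioning. *)
Lemma hoeffding_chord (R : realType) (u a s y : R) :
  0 < u -> a <= 0 -> - (2 * u) <= a -> a <= y -> y <= a + 2 * u ->
  expR (s * y) <= expR (s ^+ 2 * u ^+ 2 / 2) +
    (expR (s * (a + 2 * u)) - expR (s * a)) / (2 * u) * y.
Proof.
move=> u0 a0 ua ay yb.
(* With weights [1 - p] and [p], the two-point law on [a] and [a + 2u] has mean 0; its moment
   generating function is the value of the chord at 0. *)
pose p := - a / (2 * u).
have u20 : 2 * u != 0 by rewrite gt_eqF// mulr_gt0.
have ap : a = - (p * (2 * u)) by rewrite /p divfK// opprK.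
have p01 : 0 <= p <= 1.
  by rewrite /p divr_ge0 ?ler_pdivrMr /=; lra.
have := @bernoulli_mgf R p (2 * u * s) p01.
have -> : - (p * (2 * u * s)) = s * a by rewrite ap; ring.
have -> : (1 - p) * (2 * u * s) = s * (a + 2 * u) by rewrite ap; ring.
have -> : (2 * u * s) ^+ 2 / 8 = s ^+ 2 * u ^+ 2 / 2 by field.
move=> H.
apply: (@le_trans _ _ ((1 - p) * expR (s * a) + p * expR (s * (a + 2 * u)) +
    (expR (s * (a + 2 * u)) - expR (s * a)) / (2 * u) * y)); last by rewrite lerD2r.
pose r := (y - a) / (2 * u).
have r0 : 0 <= r by rewrite /r divr_ge0; lra.
have r1 : r <= 1 by rewrite /r ler_pdivrMr; lra.
have -> : (1 - p) * expR (s * a) + p * expR (s * (a + 2 * u)) +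
    (expR (s * (a + 2 * u)) - expR (s * a)) / (2 * u) * y
  = (1 - r) * expR (s * a) + r * expR (s * (a + 2 * u)).
  rewrite /r /p; field. by rewrite gt_eqF.
(* Convexity via the tangent at [s * y]: averaging the tangent bounds at both endpoints with weights
   [1 - r] and [r], whose barycenter is [y], leaves exactly [expR (s * y)]. *)
have tangent t : expR (s * y) * (1 + (t - s * y)) <= expR t.
  have -> : expR t = expR (s * y) * expR (t - s * y).
    by rewrite -expRD; congr expR; ring.
  by rewrite ler_wpM2l ?expR_ge0// expR_ge1Dx.
apply: le_trans (lerD (ler_wpM2l _ (tangent _)) (ler_wpM2l r0 (tangent _))); last by lra.
rewrite [leRHS](_ : _ = expR (s * y))//.
have -> : y = a + r * (2 * u) by rewrite /r divfK//; ring.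
by ring.
Qed.

(** * Integrability of bounded functions and measurability in a generated sigma-algebra *)

Lemma bounded_of_le (T : Type) (R : realType) (A : set T) (h : T -> R) (K : R) :
  (forall w, `|h w| <= K) -> [bounded h w | w in A].
Proof.
move=> hK; exists K; split => [|M KM w _]; first exact: num_real.
by rewrite /= (le_trans (hK w))// ltW.
Qed.

Lemma integrable_of_le (d : measure_display) (T : measurableType d)
  (R : realType) (P : probability T R) (h : T -> R) (K : R) :
  measurable_fun setT h -> (forall w, `|h w| <= K) ->
  P.-integrable setT (EFin \o h).
Proof.
move=> mh hK; apply: measurable_bounded_integrable => //.
  by rewrite (le_lt_trans (probability_le1 P measurableT)) ?ltry.
exact: bounded_of_le hK.
Qed.

Lemma integrableM_of_le (d : measure_display) (T : measurableType d)
  (R : realType) (P : probability T R) (h g : T -> R) (K : R) :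
  measurable_fun setT h -> (forall w, `|h w| <= K) ->
  P.-integrable setT (EFin \o g) ->
  P.-integrable setT (EFin \o (fun w => h w * g w)).
Proof.
move=> mh hK ig.
exact: (integrableMr measurableT mh (bounded_of_le _ hK) ig).
Qed.

(** A floor is the number of levels below it; this identifies the step functions used in
    [condexp_zeroM]. *)
Lemma sum_ltn_minn (N t : nat) : (\sum_(i < N) (i < t) = minn N t)%N.
Proof.
elim: N => [|N IH]; first by rewrite big_ord0 min0n.
rewrite big_ord_recr /= IH; case: (ltnP N t) => Nt.
  by move/minn_idPl: (Nt) => ->; rewrite addn1.
by move/minn_idPr: (leqW Nt) => ->; rewrite addn0.
Qed.

(** Moving to [g_sigma_algebraType S] makes the closure properties of [measurable_fun] available for
    predictable functions. *)
Lemma measurable_wrtP (T : pointedType) (R : realType) (S : set (set T)) (g : T -> R) :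
  measurable_wrt <<s S>> g <-> measurable_fun (setT : set (g_sigma_algebraType S)) g.
Proof.
split => [h _ B mB|h B mB].
  by rewrite setTI; exact: h.
by rewrite -[X in <<s S>> X]setTI; exact: h.
Qed.

Lemma g_sigma_algebra_sub (d : measure_display) (T : measurableType d)
  (S : set (set T)) : S `<=` measurable -> <<s S>> `<=` (measurable : set (set T)).
Proof.
by move=> Sm; apply: smallest_sub => //; exact: sigma_algebra_measurable.
Qed.

Lemma measurable_wrtW (d : measure_display) (T : measurableType d)
  (R : realType) (S : set (set T)) (g : T -> R) : S `<=` measurable ->
  measurable_wrt <<s S>> g -> measurable_fun setT g.
Proof.
by move=> Sm mg _ B mB; rewrite setTI; apply: (g_sigma_algebra_sub Sm); exact: mg.
Qed.

(** * Conditional centering against bounded predictable factors *)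

Lemma condexp_zero_sum_indic (d : measure_display) (T : measurableType d)
  (R : realType) (P : probability T R) (S : set (set T)) (g : T -> R)
  (A : nat -> set T) (N : nat) :
  S `<=` measurable -> condexp_zero P <<s S>> g -> (forall i, <<s S>> (A i)) ->
  \int[P]_w ((\sum_(i < N) \1_(A i) w) * g w) = 0.
Proof.
move=> Sm [ig g0] SA.
have mA i : measurable (A i) by exact: (g_sigma_algebra_sub Sm (SA i)).
have mI i : measurable_fun setT (\1_(A i) : T -> R) by exact: measurable_indic.
elim: N => [|N IH].
  under eq_Rintegral do rewrite big_ord0 mul0r.
  by rewrite Rintegral_cst// mul0r.
under eq_Rintegral do rewrite big_ord_recr/= mulrDl.
rewrite RintegralD//; last 2 first.
- apply: (@integrableM_of_le _ _ _ _ _ _ N%:R) => //.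
    exact: measurable_sum.
  move=> w; rewrite ger0_norm ?sumr_ge0// -[X in _ <= X%:R]card_ord -sum1_card natr_sum.
  by apply: ler_sum => i _; rewrite indicE; case: (_ \in _).
- apply: (@integrableM_of_le _ _ _ _ _ _ 1) => //.
  by move=> w; rewrite indicE; case: (_ \in _); rewrite ?normr1 ?normr0.
rewrite IH add0r (@eq_Rintegral _ _ _ P setT (g \_ (A N))); last first.
  by move=> w _; rewrite indicE patchE; case: (_ \in _); rewrite ?mul1r ?mul0r.
by rewrite -Rintegral_mkcond /Rintegral g0.
Qed.

(* Z is uniformly approximated by step functions (1/m) * sum_i 1{m Z >= i}. *)
Lemma condexp_zeroM (d : measure_display) (T : measurableType d)
  (R : realType) (P : probability T R) (S : set (set T)) (g Z : T -> R) (K : R) :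
  S `<=` measurable -> condexp_zero P <<s S>> g ->
  measurable_wrt <<s S>> Z -> (forall w, `|Z w| <= K) ->
  \int[P]_w (Z w * g w) = 0.
Proof.
move=> Sm cg mZ ZK; have [ig g0] := cg.
have mZT := measurable_wrtW Sm mZ.
have /measurable_wrtP mZ' := mZ.
have K0 : 0 <= K by rewrite (le_trans _ (ZK point)).
have mg : measurable_fun setT g by apply/measurable_EFinP; case/integrableP : ig.
pose L := \int[P]_w `|g w|.
have intg : \int[P]_w g w = 0.
  by rewrite /Rintegral g0//; apply: (@measurableT _ (g_sigma_algebraType S)).
have bound m : `|\int[P]_w (Z w * g w)| <= m.+1%:R^-1 * L.
  (* The shift by [K] makes [y] nonnegative, so its floor counts the levels [i.+1] that it reaches;
     [N] levels suffice because [y] is at most [m.+1 * (K + K)]. *)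
  pose y w := m.+1%:R * (Z w + K).
  have y0 w : 0 <= y w.
    by rewrite mulr_ge0// -lerBlDr sub0r; have := ZK w; rewrite ler_norml => /andP[].
  pose N := (Num.trunc (m.+1%:R * (K + K))).+1.
  pose A i := [set w : T | (i.+1%:R <= y w)].
  have SA i : <<s S>> (A i).
    have my : measurable_fun (setT : set (g_sigma_algebraType S)) y.
      by apply: measurable_funM => //; apply: measurable_funD.
    have := my measurableT `[i.+1%:R, +oo[%classic (measurable_itv _).
    rewrite setTI; congr (<<s S>> _).
    by apply/seteqP; split => w; rewrite /A/= in_itv/= andbT.
  pose s w : R := \sum_(i < N) \1_(A i) w.
  have sE w : s w = (Num.trunc (y w))%:R.
    rewrite /s -[in RHS](@minn_idPr N (Num.trunc (y w)) _); last first.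
      rewrite /N ltnW// ltnS; apply: le_truncn.
      rewrite ler_wpM2l// lerD2r.
      by have := ZK w; rewrite ler_norml => /andP[].
    rewrite -sum_ltn_minn natr_sum; apply: eq_bigr => i _.
    rewrite indicE truncn_gt_nat; congr ((nat_of_bool _)%:R).
    by apply/idP/idP; rewrite inE.
  have close w : `|Z w - (m.+1%:R^-1 * s w - K)| <= m.+1%:R^-1.
    rewrite -[leRHS]mulr1.
    have -> : Z w - (m.+1%:R^-1 * s w - K) = m.+1%:R^-1 * (y w - s w).
      by rewrite mulrBr /y mulKf ?pnatr_eq0//; ring.
    rewrite normrM ger0_norm ?invr_ge0// ler_wpM2l ?invr_ge0//.
    rewrite sE; have /andP[t1 t2] := truncn_itv (y0 w).
    rewrite ger0_norm ?subr_ge0// lerBlDr addrC natr1; exact: ltW.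
  have s_ge0 w : 0 <= s w by rewrite sE.
  have sN w : `|s w| <= N%:R.
    rewrite ger0_norm // /s -[X in _ <= X%:R]card_ord -sum1_card natr_sum.
    by apply: ler_sum => i _; rewrite indicE; case: (_ \in _).
  have ms : measurable_fun setT s.
    apply: measurable_sum => i; apply: measurable_indic.
    exact: (g_sigma_algebra_sub Sm (SA i)).
  have is' : P.-integrable setT (EFin \o (fun w => s w * g w)).
    exact: integrableM_of_le ms sN ig.
  have iZ : P.-integrable setT (EFin \o (fun w => Z w * g w)).
    exact: integrableM_of_le mZT ZK ig.
  have s0 : \int[P]_w ((m.+1%:R^-1 * s w - K) * g w) = 0.
    rewrite (@eq_Rintegral _ _ _ P setT (fun w => m.+1%:R^-1 * (s w * g w) - K * g w)); last first.
      by move=> w _; rewrite mulrBl mulrA.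
    rewrite RintegralB//; last 2 first.
    - exact: (integrableZl measurableT m.+1%:R^-1 is').
    - exact: (integrableZl measurableT K ig).
    rewrite !RintegralZl// intg mulr0 subr0.
    by rewrite (condexp_zero_sum_indic N Sm cg SA) mulr0.
  have isk : P.-integrable setT (EFin \o (fun w => (m.+1%:R^-1 * s w - K) * g w)).
    apply: (@integrableM_of_le _ _ _ _ _ _ (m.+1%:R^-1 * N%:R + K)) => //.
      by apply: measurable_funB => //; apply: measurable_funM.
    move=> w; apply: (le_trans (ler_normB _ _)).
    by rewrite (ger0_norm K0) lerD2r normrM ger0_norm ?invr_ge0// ler_wpM2l ?invr_ge0.
  have iD : P.-integrable setT (EFin \o (fun w => (Z w - (m.+1%:R^-1 * s w - K)) * g w)).
    apply: integrableM_of_le close ig.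
    by apply: measurable_funB => //; apply: measurable_funB => //; apply: measurable_funM.
  have ia : P.-integrable setT (EFin \o (fun w => `|g w|)).
    exact: (integrable_norm ig).
  have -> : \int[P]_w (Z w * g w) =
      \int[P]_w ((Z w - (m.+1%:R^-1 * s w - K)) * g w).
    rewrite [RHS](@eq_Rintegral _ _ _ P setT (fun w => Z w * g w - (m.+1%:R^-1 * s w - K) * g w)).
      by rewrite RintegralB// s0 subr0.
    by move=> w _; rewrite mulrBl.
  apply: (le_trans (le_normr_Rintegral measurableT iD)).
  rewrite -RintegralZl//; apply: le_Rintegral => //.
  - exact: (integrable_norm iD).
  - exact: (integrableZl measurableT m.+1%:R^-1 ia).
  - by move=> w _; rewrite normrM ler_wpM2r.
apply/eqP; rewrite -normr_le0; apply/ler_addgt0Pr => e e0; rewrite add0r.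
have L0 : 0 <= L by apply: Rintegral_ge0.
pose m := Num.trunc (L / e).
apply: (le_trans (bound m)); rewrite mulrC ler_pdivrMr// mulrC -ler_pdivrMr//.
exact/ltW/truncnS_gt.
Qed.

(** * Azuma's inequality with predictable coefficients *)

(* Conditions for the sums of Y i * e i (m <= i < k) to satisfy an Azuma bound: *)
(* e i is conditionally centered and confined to a predictable interval *)
(* [a i, a i + 2u], which is only required to contain 0 where Y i != 0. *)
Record azuma_sum (d : measure_display) (T : measurableType d) (R : realType)
  (P : probability T R) (S : nat -> set (set T)) (Y e a : nat -> T -> R)
  (u M : R) (m k : nat) : Prop := AzumaSum {
  azuma_sub : forall j, (m <= j < k)%N -> S j `<=` measurable ;
  azuma_center : forall j, (m <= j < k)%N -> condexp_zero P <<s S j>> (e j) ;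
  azuma_coef : forall j, (m <= j < k)%N -> measurable_wrt <<s S j>> (Y j) ;
  azuma_low : forall j, (m <= j < k)%N -> measurable_wrt <<s S j>> (a j) ;
  azuma_past : forall i j, (m <= i < j)%N -> (j < k)%N ->
    measurable_wrt <<s S j>> (fun w => Y i w * e i w) ;
  azuma_itv : forall j, (m <= j < k)%N ->
    forall w, a j w <= e j w <= a j w + 2 * u ;
  azuma_zero : forall j, (m <= j < k)%N ->
    forall w, Y j w != 0 -> - (2 * u) <= a j w <= 0 ;
  azuma_le : forall j, (m <= j < k)%N -> forall w, `|Y j w| <= M }.

Lemma azuma_sumW (d : measure_display) (T : measurableType d) (R : realType)
  (P : probability T R) (S : nat -> set (set T)) (Y e a : nat -> T -> R)
  (u M : R) (m k l : nat) : (l <= k)%N ->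
  azuma_sum P S Y e a u M m k -> azuma_sum P S Y e a u M m l.
Proof.
move=> lk [h1 h2 h3 h4 h5 h6 h7 h8].
have r j : (m <= j < l)%N -> (m <= j < k)%N.
  by move=> /andP[-> jl]; exact: leq_trans jl lk.
split; try by move=> j /r; auto.
by move=> i j ij jl; apply: h5 => //; exact: leq_trans jl lk.
Qed.

Lemma azuma_term_le (d : measure_display) (T : measurableType d) (R : realType)
  (P : probability T R) (S : nat -> set (set T)) (Y e a : nat -> T -> R)
  (u M : R) (m k j : nat) (w : T) : 0 <= u ->
  azuma_sum P S Y e a u M m k -> (m <= j < k)%N ->
  `|Y j w * e j w| <= M * (2 * u).
Proof.
move=> u0 H mj; have M0 : 0 <= M := le_trans (normr_ge0 _) (azuma_le H mj w).
have [->|Y0] := eqVneq (Y j w) 0; first by rewrite mul0r normr0 !mulr_ge0.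
rewrite normrM ler_pM// ?(azuma_le H mj)// ler_norml.
have /andP[? ?] := azuma_zero H mj Y0.
by have /andP[? ?] := azuma_itv H mj w; apply/andP; split; lra.
Qed.

Lemma azuma_sum_le (d : measure_display) (T : measurableType d) (R : realType)
  (P : probability T R) (S : nat -> set (set T)) (Y e a : nat -> T -> R)
  (u M : R) (m k : nat) (w : T) : 0 <= u ->
  azuma_sum P S Y e a u M m k ->
  `|\sum_(m <= i < k) Y i w * e i w| <= (k - m)%:R * (M * (2 * u)).
Proof.
move=> u0 H; apply: (le_trans (ler_norm_sum _ _ _)).
rewrite mulr_natl -sumr_const_nat.
by apply: ler_sum_nat => j mj; exact: azuma_term_le H mj.
Qed.

Lemma measurable_wrt_sum (T : pointedType) (R : realType) (S : set (set T))
  (f : nat -> T -> R) (m k : nat) :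
  (forall i, (m <= i < k)%N -> measurable_wrt <<s S>> (f i)) ->
  measurable_wrt <<s S>> (fun w => \sum_(m <= i < k) f i w).
Proof.
move=> mf; apply/measurable_wrtP.
rewrite (_ : (fun w => _) = fun w => \sum_(i <- [seq j <- index_iota m k | (m <= j < k)%N]) f i w).
  (* Setting the terms outside the range to 0 makes every index measurable, as [measurable_sum]
     demands. *)
  pose h i := if (m <= i < k)%N then f i else cst 0.
  rewrite (_ : (fun w => _) = fun w =>
    \sum_(i <- [seq j <- index_iota m k | (m <= j < k)%N]) h i w).
    apply: measurable_sum => i; rewrite /h; case: ifPn => [/mf/measurable_wrtP//|_].
    exact: measurable_cst.
  apply/funext => w; rewrite !big_filter; apply: eq_bigr => i mi.
  by rewrite /h mi.
apply/funext => w; rewrite big_filter [LHS]big_nat_cond.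
by apply: eq_bigl => i; rewrite andbT.
Qed.

(** Induction on the number of terms: the chord bound replaces the last exponential by a constant
    factor plus a predictable multiple of [e k], and the latter, times the bounded exponential of
    the past, integrates to 0. *)
Lemma azuma_mgf (d : measure_display) (T : measurableType d) (R : realType)
  (P : probability T R) (S : nat -> set (set T)) (Y e a : nat -> T -> R)
  (u M t : R) (m l : nat) : 0 < u ->
  azuma_sum P S Y e a u M m (m + l) ->
  \int[P]_w expR (t * \sum_(m <= i < m + l) Y i w * e i w) <=
  expR (l%:R * (t ^+ 2 * u ^+ 2 * M ^+ 2 / 2)).
Proof.
move=> u0; elim: l => [|l IH] H.
  under eq_Rintegral do rewrite addn0 big_geq// mulr0 expR0.
  rewrite Rintegral_cst//. by rewrite [X in fine X]probability_setT mul0r expR0 mul1r.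
have H' : azuma_sum P S Y e a u M m (m + l).
  by apply: azuma_sumW H; rewrite leq_add2l.
have {}IH := IH H'.
have mk : (m <= m + l < m + l.+1)%N by rewrite leq_addr ltn_add2l ltnSn.
have M0 : 0 <= M := le_trans (normr_ge0 _) (azuma_le H mk point).
set k := (m + l)%N in H' IH mk *.
have Sk := azuma_sub H mk.
have mY := azuma_coef H mk; have ma := azuma_low H mk.
have [ie _] := azuma_center H mk.
pose s w := \sum_(m <= i < k) Y i w * e i w.
have ms : measurable_wrt <<s S k>> s.
  apply: measurable_wrt_sum => i mi; apply: (azuma_past H) => //.
  by rewrite /k addnS.
(* [W] is the exponential of the past, [H1] the chord slope at [s = t * Y k w], and [c] the cost of
   one step. The bounds [KW] and [KH] make the product [W * H1] admissible in [condexp_zeroM]. *)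
pose W w := expR (t * s w).
pose H1 w := (expR (t * Y k w * (a k w + 2 * u)) - expR (t * Y k w * a k w)) / (2 * u).
pose c : R := expR (t ^+ 2 * u ^+ 2 * M ^+ 2 / 2).
pose KW := expR (`|t| * (l%:R * (M * (2 * u)))).
have WK w : `|W w| <= KW.
  rewrite ger0_norm ?expR_ge0// ler_expR (le_trans (ler_norm _))// normrM.
  rewrite ler_wpM2l// (le_trans (azuma_sum_le w (ltW u0) H'))//.
  by rewrite /k addKn.
pose KH := 2 * expR (`|t| * (M * (2 * u))) / (2 * u).
have u20 : 0 < 2 * u by rewrite mulr_gt0.
have HK w : `|H1 w| <= KH.
  have [Y0|Y0] := eqVneq (Y k w) 0.
    rewrite /H1 Y0 mulr0 !mul0r subrr mul0r normr0.
    by rewrite divr_ge0 ?mulr_ge0 ?expR_ge0// ltW.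
  have /andP[a1 a2] := azuma_zero H mk Y0.
  have E z : `|z| <= 2 * u -> expR (t * Y k w * z) <= expR (`|t| * (M * (2 * u))).
    move=> zu; rewrite ler_expR (le_trans (ler_norm _))// !normrM -mulrA.
    by rewrite ler_wpM2l// ler_pM// (azuma_le H mk).
  rewrite /H1 normrM (gtr0_norm (x := (2 * u)^-1)) ?invr_gt0// ler_wpM2r ?invr_ge0 ?(ltW u20)//.
  rewrite (le_trans (ler_normB _ _))// [2 * expR _]mulr_natl [expR _ *+ 2]mulr2n !(ger0_norm (expR_ge0 _)).
  by apply: lerD; apply: E; rewrite ler_norml; apply/andP; split; lra.
have mW : measurable_wrt <<s S k>> W.
  move/measurable_wrtP: ms => ms; apply/measurable_wrtP.
  apply: measurableT_comp; first exact: measurable_expR.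
  exact: measurable_funM.
have mWT := measurable_wrtW Sk mW.
have mWH : measurable_wrt <<s S k>> (fun w => W w * H1 w).
  move/measurable_wrtP: mW => mW; apply/measurable_wrtP.
  move/measurable_wrtP: mY => mY; move/measurable_wrtP: ma => ma.
  apply: measurable_funM => //; apply: measurable_funM => //.
  apply: measurable_funB; apply: measurableT_comp => //.
    by apply: measurable_funM; [exact: measurable_funM|exact: measurable_funD].
  by apply: measurable_funM => //; exact: measurable_funM.
have WHK w : `|W w * H1 w| <= KW * KH by rewrite normrM ler_pM.
have int0 := condexp_zeroM Sk (azuma_center H mk) mWH WHK.
have iW : P.-integrable setT (EFin \o W) := integrable_of_le P mWT WK.
have icW : P.-integrable setT (EFin \o (fun w => c * W w)).
  exact: (integrableZl measurableT c iW).
have iWH : P.-integrable setT (EFin \o (fun w => W w * H1 w * e k w)).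
  exact: integrableM_of_le (measurable_wrtW Sk mWH) WHK ie.
have sE w : \sum_(m <= i < m + l.+1) Y i w * e i w = s w + Y k w * e k w.
  by rewrite addnS big_nat_recr//= leq_addr.
have me : measurable_fun setT (e k) by apply/measurable_EFinP; case/integrableP : ie.
have iL : P.-integrable setT
    (EFin \o (fun w => expR (t * \sum_(m <= i < m + l.+1) Y i w * e i w))).
  apply: (@integrable_of_le _ _ _ _ _ (expR (`|t| * (l.+1%:R * (M * (2 * u)))))).
    apply: measurableT_comp; first exact: measurable_expR.
    apply: measurable_funM => //; under eq_fun do rewrite sE.
    apply: measurable_funD; first exact: measurable_wrtW ms.
    by apply: measurable_funM => //; exact: measurable_wrtW mY.
  move=> w; rewrite ger0_norm ?expR_ge0// ler_expR (le_trans (ler_norm _))// normrM.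
  rewrite ler_wpM2l// (le_trans (azuma_sum_le w (ltW u0) H))//.
  by rewrite addKn.
have pw w : expR (t * \sum_(m <= i < m + l.+1) Y i w * e i w) <=
    c * W w + W w * H1 w * e k w.
  rewrite sE mulrDr expRD -/(W w) -mulrA [c * _]mulrC -mulrDr ler_wpM2l ?expR_ge0//.
  have [Y0|Y0] := eqVneq (Y k w) 0.
    rewrite /H1 Y0 mulr0 !mul0r subrr !mul0r addr0 mulr0 expR0.
    by rewrite -[leLHS]expR0 ler_expR divr_ge0// -!exprMn sqr_ge0.
  have /andP[a1 a2] := azuma_zero H mk Y0.
  have /andP[a3 a4] := azuma_itv H mk w.
  rewrite mulrA; apply: (le_trans (hoeffding_chord _ u0 a2 a1 a3 a4)).
  have YM : Y k w ^+ 2 <= M ^+ 2.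
    rewrite -[Y k w ^+ 2]real_normK ?num_real// ler_sqr ?nnegrE//.
    exact: (azuma_le H mk).
  by rewrite lerD2r ler_expR; have := ler_wpM2l (sqr_ge0 (t * u)) YM; rewrite !exprMn; lra.
apply: (@le_trans _ _ (\int[P]_w (c * W w + W w * H1 w * e k w))).
  apply: le_Rintegral => //.
  exact: (integrableD measurableT icW iWH).
rewrite RintegralD// int0 addr0 RintegralZl//.
rewrite -[in leRHS]natr1 mulrDl mul1r expRD mulrC ler_wpM2r// expR_ge0//.
Qed.

Lemma azuma_sum_measurable (d : measure_display) (T : measurableType d) (R : realType)
  (P : probability T R) (S : nat -> set (set T)) (Y e a : nat -> T -> R)
  (u M : R) (m l : nat) : azuma_sum P S Y e a u M m (m + l) ->
  measurable_fun setT (fun w => \sum_(m <= i < m + l) Y i w * e i w).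
Proof.
elim: l => [|l IH] H.
  by under eq_fun do rewrite addn0 big_geq//; exact: measurable_cst.
have H' : azuma_sum P S Y e a u M m (m + l).
  by apply: azuma_sumW H; rewrite leq_add2l.
have mk : (m <= m + l < m + l.+1)%N by rewrite leq_addr ltn_add2l ltnSn.
under eq_fun do rewrite addnS big_nat_recr ?leq_addr//=.
apply: measurable_funD; first exact: IH.
apply: measurable_funM; first exact: (measurable_wrtW (azuma_sub H mk) (azuma_coef H mk)).
by have [/integrableP[+ _] _] := azuma_center H mk; move/measurable_EFinP.
Qed.

Lemma azuma_tail (d : measure_display) (T : measurableType d) (R : realType)
  (P : probability T R) (S : nat -> set (set T)) (Y e a : nat -> T -> R)
  (u M lam : R) (m l n : nat) : 0 <= u -> 0 <= M -> 0 < lam -> (0 < n)%N -> (l <= n)%N ->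
  azuma_sum P S Y e a u M m (m + l) ->
  (P [set w | (lam * Num.sqrt n%:R * u * M < \sum_(m <= i < m + l) Y i w * e i w)%R]
    <= (expR (- (lam ^+ 2 / 2)))%:E)%E.
Proof.
move=> u0 M0 lam0 n0 ln H.
set A := [set w | _].
have ms := azuma_sum_measurable H.
have mA : measurable A.
  rewrite (_ : A = (fun w => \sum_(m <= i < m + l) Y i w * e i w) @^-1`
      `]lam * Num.sqrt n%:R * u * M, +oo[%classic).
    by rewrite -[X in measurable X]setTI; exact: ms.
  by apply/seteqP; split => w /=; rewrite in_itv/= andbT.
(* If [u * M = 0] the sum vanishes identically and the event is empty; the optimal [t] below would
   divide by 0. *)
have [uM|uM] := eqVneq (u * M) 0.
  rewrite (_ : A = set0) ?measure0 ?lee_fin ?expR_ge0//.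
  apply/seteqP; split => // w; rewrite /A/= -[_ * u * M]mulrA uM mulr0.
  have := azuma_sum_le w u0 H; rewrite [M * _]mulrCA [M * u]mulrC uM !mulr0.
  by rewrite normr_le0 => /eqP ->; rewrite ltxx.
have u0' : 0 < u by rewrite lt_neqAle u0 andbT eq_sym; apply: contraNneq uM => ->; rewrite mul0r.
have M0' : 0 < M by rewrite lt_neqAle M0 andbT eq_sym; apply: contraNneq uM => ->; rewrite mulr0.
have sn0 : 0 < Num.sqrt n%:R :> R by rewrite sqrtr_gt0 ltr0n.
pose V := Num.sqrt n%:R * u * M.
have V0 : 0 < V by rewrite !mulr_gt0.
(* This [t] minimizes [t^2 V^2 / 2 - t lam V], with minimum [- lam^2 / 2]. Using [n] instead of [l]
   in [V] gives one threshold for all lengths. *)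
pose t := lam / V.
have t0 : 0 < t by rewrite divr_gt0.
pose s w := \sum_(m <= i < m + l) Y i w * e i w.
have mgf : \int[P]_w expR (t * s w) <= expR (lam ^+ 2 / 2).
  apply: (le_trans (azuma_mgf t u0' H)); rewrite ler_expR.
  have -> : lam ^+ 2 / 2 = n%:R * (t ^+ 2 * u ^+ 2 * M ^+ 2 / 2).
    have -> : lam = t * V by rewrite /t divfK// gt_eqF.
    rewrite /V !exprMn sqr_sqrtr ?ler0n//; ring.
  by rewrite ler_wpM2r ?ler_nat// divr_ge0// -!exprMn sqr_ge0.
have ie : P.-integrable setT (EFin \o (fun w => expR (t * s w))).
  apply: (@integrable_of_le _ _ _ _ _ (expR (`|t| * (l%:R * (M * (2 * u)))))).
    by apply: measurableT_comp; [exact: measurable_expR|exact: measurable_funM].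
  move=> w; rewrite ger0_norm ?expR_ge0// ler_expR (le_trans (ler_norm _))// normrM.
  by rewrite ler_wpM2l// (le_trans (azuma_sum_le w u0 H))// addKn.
have i1 : P.-integrable setT (EFin \o (\1_A : T -> R)).
  exact: integrable_indic.
have PA : P A = (\int[P]_w \1_A w)%:E.
  rewrite /Rintegral integral_indic// setIT fineK//.
  exact: fin_num_measure.
rewrite PA lee_fin expRN -div1r ler_pdivlMr ?expR_gt0//.
(* Markov's inequality: on [A] the exponential exceeds [expR (lam ^+ 2)], written as a square so
   that one factor cancels against [mgf]. *)
have E2 : expR (lam ^+ 2 / 2) * expR (lam ^+ 2 / 2) = expR (t * (lam * V)).
  rewrite -expRD; congr expR; rewrite /t mulrCA divfK ?gt_eqF//; lra.
rewrite -(ler_pM2l (expR_gt0 (lam ^+ 2 / 2))) mulr1 mulrCA E2 mulrC.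
rewrite -RintegralZl//; apply: le_trans mgf; apply: le_Rintegral => //.
  exact: (integrableZl measurableT _ i1).
move=> w _; rewrite indicE; case: (boolP (w \in A)) => [|_]; last by rewrite mulr0 expR_ge0.
rewrite inE /A/= => As; rewrite mulr1 ler_expR ler_pM2l// ltW//.
by rewrite /V mulrA mulrA.
Qed.

Lemma azuma_sumN (d : measure_display) (T : measurableType d) (R : realType)
  (P : probability T R) (S : nat -> set (set T)) (Y e a : nat -> T -> R)
  (u M : R) (m k : nat) :
  azuma_sum P S Y e a u M m k -> azuma_sum P S (fun i w => - Y i w) e a u M m k.
Proof.
move=> [h1 h2 h3 h4 h5 h6 h7 h8]; split => //.
- move=> j /h3/measurable_wrtP h; apply/measurable_wrtP.
  exact: measurable_funN.
- move=> i j ij jk; have /measurable_wrtP h := h5 i j ij jk; apply/measurable_wrtP.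
  under eq_fun do rewrite mulNr; exact: measurable_funN.
- by move=> j /h7 h w; rewrite oppr_eq0; exact: h.
- by move=> j /h8 h w; rewrite normrN; exact: h.
Qed.

Lemma azuma_tail_norm (d : measure_display) (T : measurableType d) (R : realType)
  (P : probability T R) (S : nat -> set (set T)) (Y e a : nat -> T -> R)
  (u M lam : R) (m l n : nat) : 0 <= u -> 0 <= M -> 0 < lam -> (0 < n)%N -> (l <= n)%N ->
  azuma_sum P S Y e a u M m (m + l) ->
  exists A : set T, [/\ measurable A, (P A <= (2 * expR (- (lam ^+ 2 / 2)))%:E)%E &
    forall w, ~ A w ->
      `|\sum_(m <= i < m + l) Y i w * e i w| <= lam * Num.sqrt n%:R * u * M].
Proof.
move=> u0 M0 lam0 n0 ln H; have H' := azuma_sumN H.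
set thr := lam * _ * u * M.
pose A := [set w | thr < \sum_(m <= i < m + l) Y i w * e i w].
pose B := [set w | thr < \sum_(m <= i < m + l) - Y i w * e i w].
have mgt (f : T -> R) : measurable_fun setT f -> measurable [set w | thr < f w].
  move=> mf; rewrite (_ : [set _ | _] = f @^-1` `]thr, +oo[%classic).
    by rewrite -[X in measurable X]setTI; exact: mf.
  by apply/seteqP; split => w /=; rewrite in_itv/= andbT.
have mA : measurable A by apply: mgt; exact: azuma_sum_measurable H.
have mB : measurable B by apply: mgt; exact: azuma_sum_measurable H'.
exists (A `|` B); split; first exact: measurableU.
  apply: (le_trans (measureU2 _ mA mB)); rewrite mulr_natl mulr2n EFinD.
  by apply: leeD; [exact: azuma_tail H|exact: azuma_tail H'].
move=> w ABw.
have Aw : \sum_(m <= i < m + l) Y i w * e i w <= thr.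
  by rewrite leNgt; apply/negP => Aw; apply: ABw; left.
have : \sum_(m <= i < m + l) - Y i w * e i w <= thr.
  by rewrite leNgt; apply/negP => Bw; apply: ABw; right.
under eq_bigr do rewrite mulNr.
by rewrite sumrN lerNl => Bw; rewrite ler_norml Aw Bw.
Qed.

(* Stopping the sum when it first exceeds the threshold keeps it an Azuma sum. *)
Lemma azuma_max (d : measure_display) (T : measurableType d) (R : realType)
  (P : probability T R) (S : nat -> set (set T)) (Y e a : nat -> T -> R)
  (u M lam : R) (m n : nat) : 0 <= u -> 0 <= M -> 0 < lam -> (0 < n)%N ->
  azuma_sum P S Y e a u M m (m + n) ->
  exists A : set T, [/\ measurable A, (P A <= (2 * expR (- (lam ^+ 2 / 2)))%:E)%E &
    forall w, ~ A w -> forall l, (l <= n)%N ->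
      `|\sum_(m <= i < m + l) Y i w * e i w| <= lam * Num.sqrt n%:R * u * M].
Proof.
move=> u0 M0 lam0 n0 H.
set thr := lam * _ * u * M.
pose s j w := \sum_(m <= i < j) Y i w * e i w.
(* Since [s i] only sums indices below [i], [good j] depends on the terms before [j] and is
   therefore predictable. *)
pose good j w : R := \prod_(m <= i < j.+1) \1_(`[- thr, thr]%classic) (s i w).
have mgood j : (m <= j < m + n)%N -> measurable_wrt <<s S j>> (good j).
  move=> mj; apply/measurable_wrtP; rewrite /good.
  apply: measurable_prod => i; rewrite mem_index_iota => /andP[mi ij].
  apply: measurableT_comp; first exact: measurable_indic.
  apply/measurable_wrtP; apply: measurable_wrt_sum => i' /andP[mi' i'i].
  have /andP[_ jk] := mj; apply: (azuma_past H) jk.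
  by rewrite mi' (leq_trans i'i).
have good01 j w : good j w = 0 \/ good j w = 1.
  rewrite /good; elim/big_ind : _ => [|x y|i _]; first by right.
    by move=> [->|->] [->|->]; rewrite ?mulr0 ?mulr1 ?mul0r; auto.
  by rewrite indicE; case: (_ \in _); auto.
have H' : azuma_sum P S (fun j w => Y j w * good j w) e a u M m (m + n).
  case: (H) => h1 h2 h3 h4 h5 h6 h7 h8; split => //.
  - move=> j mj; apply/measurable_wrtP; apply: measurable_funM; apply/measurable_wrtP.
      exact: h3.
    exact: mgood.
  - move=> i j /andP[mi ij] jk; apply/measurable_wrtP.
    under eq_fun do rewrite mulrAC.
    apply: measurable_funM; first by apply/measurable_wrtP; apply: h5 => //; rewrite mi.
    apply: measurable_prod => i'; rewrite mem_index_iota => /andP[mi' i'j].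
    apply: measurableT_comp; first exact: measurable_indic.
    apply/measurable_wrtP; apply: measurable_wrt_sum => i2 /andP[mi2 i2i].
    apply: h5 jk; rewrite mi2/=; apply: leq_trans i2i _; apply: leq_trans ij.
    by rewrite -ltnS (leq_trans i'j)//; apply: leqW.
  - move=> j mj w Yg; apply: h7 => //; apply: contraNneq Yg => ->.
    by rewrite mul0r.
  - move=> j mj w; case: (good01 j w) => ->; rewrite ?mulr0 ?mulr1 ?normr0//.
    exact: h8.
have [A [mA PA HA]] := azuma_tail_norm u0 M0 lam0 n0 (leqnn n) H'.
exists A; split=> // w /HA Sw l ln.
rewrite leNgt; apply/negP => sl.
have ex : exists j, (j <= n)%N && (thr < `|s (m + j)%N w|) by exists l; rewrite ln.
(* At the first exit time [m + j] the stopped sum freezes, so its final value is [s (m + j)],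
   already beyond the threshold: a contradiction. *)
case: (ex_minnP ex) => j /andP[jn sj] jmin.
move: Sw; apply/negP; rewrite -ltNge.
suff -> : \sum_(m <= i < m + n) Y i w * good i w * e i w = s (m + j)%N w by [].
rewrite (big_cat_nat (n := (m + j)%N)) ?leq_addr ?leq_add2l//=.
rewrite [X in _ + X]big1_seq ?addr0.
  apply: eq_big_nat => i /andP[mi ij].
  rewrite (_ : good i w = 1) ?mulr1// /good big_nat big1// => i' /andP[mi' i'i].
  rewrite indicE mem_set//= in_itv/= -ler_norml leNgt; apply/negP => si'.
  have : (j <= i' - m)%N.
    apply: jmin; rewrite subnKC// si' andbT.
    rewrite (leq_trans _ jn)// leq_subLR; exact: (ltnW (leq_trans i'i ij)).
  by rewrite leqNgt ltn_subLR// (leq_ltn_trans _ ij).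
move=> i /andP[_]; rewrite mem_index_iota => /andP[ji ik].
rewrite (_ : good i w = 0) ?mulr0 ?mul0r// /good.
rewrite (bigD1_seq (m + j)%N) ?iota_uniq//=; last first.
  by rewrite mem_index_iota leq_addr ltnS.
rewrite indicE memNset ?mul0r//= in_itv/= -ler_norml leNgt.
by move/negP; apply.
Qed.

(** * Independent variables are conditionally centered given the past *)

Lemma preims_measurable (d : measure_display) (T : measurableType d) (R : realType)
  (f : nat -> T -> R) (I : set nat) :
  (forall i, I i -> measurable_fun setT (f i)) -> preims f I `<=` measurable.
Proof.
move=> mf _ [i [Ii [B [mB ->]]]].
by rewrite -[X in measurable X]setTI; exact: mf.
Qed.

Lemma measurable_wrt_preims (T : Type) (R : realType) (f : nat -> T -> R)
  (I : set nat) (S : set (set T)) (i : nat) : I i -> preims f I `<=` S ->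
  measurable_wrt <<s S>> (f i).
Proof.
by move=> Ii IS B mB; apply: sub_gen_smallest; apply: IS; exists i; split=> //; exists B.
Qed.

(** A pi-system argument: the finite measures [P (_ & X)] and [P X * P _] agree on the cylinders
    [G], which are stable under intersection and generate the past. *)
Lemma indep_past (d : measure_display) (T : measurableType d) (R : realType)
  (P : probability T R) (x : nat -> T -> R) (n k : nat) (A : set T) (D : set R) :
  (forall i, (1 <= i <= n)%N -> measurable_fun setT (x i)) ->
  mutually_independent P x n -> (1 <= k <= n)%N ->
  <<s preims x [set i | (1 <= i < k)%N] >> A -> measurable D ->
  P (A `&` x k @^-1` D) = (P A * P (x k @^-1` D))%E.
Proof.
move=> mx ind kn SA mD; have /andP[k1 kn'] := kn.
set X := x k @^-1` D.
have mxB i (B : set R) : (1 <= i <= n)%N -> measurable B -> measurable (x i @^-1` B).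
  by move=> hi mB; rewrite -[X in measurable X]setTI; exact: mx.
have mX : measurable X by exact: mxB.
pose J := [set i | (1 <= i < k)%N].
have Jn i : J i -> (1 <= i <= n)%N.
  by move=> /andP[-> ik] /=; rewrite (leq_trans (ltnW ik)).
pose G := [set E : set T | exists B : nat -> set R, (forall i, measurable (B i)) /\
  E = \bigcap_(i in J) (x i @^-1` B i)].
have GT : G setT.
  by exists (fun=> setT); split=> //; apply/seteqP; split.
have Gm : G `<=` measurable.
  move=> _ [B [mB ->]]; apply: bigcap_measurableType => i Ji.
  by apply: mxB => //; exact: Jn.
have GI : setI_closed G.
  move=> _ _ [B [mB ->]] [B' [mB' ->]]; exists (fun i => B i `&` B' i); split.
    by move=> i; exact: measurableI.
  by rewrite -bigcapI; apply: eq_bigcapr => i _; rewrite preimage_setI.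
have SG : preims x J `<=` G.
  move=> _ [i [Ji [B [mB ->]]]]; exists (fun j => if j == i then B else setT); split.
    by move=> j; case: ifP.
  apply/seteqP; split => [w Bw j Jj|w /(_ i Ji)]; last by rewrite eqxx.
  by case: eqP => [->|].
have {}SA : <<s G>> A by apply: (sub_sigma_algebra2 SG).
pose c : {nonneg R} := NngNum (fine_ge0 (measure_ge0 P X)).
have cE : (c%:num)%:E = P X by rewrite /= fineK// fin_num_measure.
pose m1 : {measure set T -> \bar R} := mrestr P mX.
pose m2 : {measure set T -> \bar R} := mscale c P.
suff : m1 A = m2 A by rewrite /m1 /m2 /= /mrestr /mscale cE muleC.
apply: (@g_sigma_algebra_measure_unique _ _ _ G Gm (fun=> setT)) => //.
- by rewrite bigcup_const.
- move=> _ [B [mB ->]]; rewrite /m1 /m2 /= /mrestr /mscale cE.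
  (* Independence is stated for all [n] variables at once, so unconstrained indices receive [setT];
     [B1] and [B2] differ only at [k]. *)
  pose B1 i := if (i < k)%N then B i else setT.
  pose B2 i := if (i < k)%N then B i else if i == k then D else setT.
  have mB1 i : measurable (B1 i) by rewrite /B1; case: ifP.
  have mB2 i : measurable (B2 i) by rewrite /B2; case: ifP => // _; case: ifP.
  have E1 : \bigcap_(i in J) (x i @^-1` B i) =
      \bigcap_(i in [set i | (1 <= i <= n)%N]) (x i @^-1` B1 i).
    apply/seteqP; split => [w h i /andP[i1 _]|w h i Ji].
      by rewrite /B1; case: ifPn => // ik; apply: h; rewrite /J/= i1.
    by have := h i (Jn _ Ji); rewrite /B1; case/andP: Ji => _ ->.
  have E2 : \bigcap_(i in J) (x i @^-1` B i) `&` X =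
      \bigcap_(i in [set i | (1 <= i <= n)%N]) (x i @^-1` B2 i).
    apply/seteqP; split => [w [h Xw] i /andP[i1 _]|w h].
      rewrite /B2; case: ifPn => [ik|_]; first by apply: h; rewrite /J/= i1.
      by case: eqP => // ->.
    split=> [i Ji|].
      by have := h i (Jn _ Ji); rewrite /B2; case/andP: Ji => _ ->.
    by have := h k kn; rewrite /B2 ltnn eqxx.
  suff : P (\bigcap_(i in J) (x i @^-1` B i) `&` X) =
      (P X * P (\bigcap_(i in J) (x i @^-1` B i)))%E by [].
  rewrite E2 E1 (ind _ mB1) (ind _ mB2).
  have kr : k \in index_iota 1 n.+1 by rewrite mem_index_iota ltnS.
  rewrite (bigD1_seq k) ?iota_uniq//= [in RHS](bigD1_seq k) ?iota_uniq//=.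
  rewrite {1}/B2 {1}/B1 ltnn eqxx preimage_setT probability_setT mul1e; congr (_ * _)%E.
  apply: eq_bigr => i ik; rewrite /B1 /B2; case: ifP => // _.
  by rewrite (negbTE ik).
- by move=> _; rewrite /m1/= /mrestr setTI -ge0_fin_numE// fin_num_measure.
Qed.

(** The roles are exchanged: for [A] in the past, [\1_A - P A] is centered given [x k], while
    [x k - mu] is bounded and a function of [x k]. Hence [condexp_zeroM] makes their product
    integrate to 0, and the mean of [x k] does the rest. *)
Lemma indep_condexp_zero (d : measure_display) (T : measurableType d) (R : realType)
  (P : probability T R) (x : nat -> T -> R) (n k : nat) (mu C : R) :
  (forall i, (1 <= i <= n)%N -> measurable_fun setT (x i)) ->
  mutually_independent P x n -> (1 <= k <= n)%N ->
  (\int[P]_w (x k w)%:E = mu%:E)%E -> (forall w, `|x k w - mu| <= C) ->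
  condexp_zero P <<s preims x [set i | (1 <= i < k)%N] >> (fun w => x k w - mu).
Proof.
move=> mx ind kn Ex xC; have /andP[k1 kn'] := kn.
have mxk := mx k kn.
have my : measurable_fun setT (fun w => x k w - mu) by exact: measurable_funB.
have iy : P.-integrable setT (EFin \o (fun w => x k w - mu)) := integrable_of_le P my xC.
split=> // A SA.
have mA : measurable A.
  apply: (g_sigma_algebra_sub _ SA); apply: preims_measurable => i /andP[i1 ik].
  by apply: mx; rewrite i1 (leq_trans (ltnW ik)).
pose S := preimage_set_system setT (x k) measurable.
have Sm : S `<=` measurable by move=> _ [B mB <-]; exact: mxk.
pose c := fine (P A).
have cE : c%:E = P A by rewrite fineK// fin_num_measure.
have mI E : measurable E -> measurable_fun setT (\1_E : T -> R).
  by move=> mE; exact: measurable_indic.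
have mg : measurable_fun setT (fun w => \1_A w - c : R).
  by apply: measurable_funB => //; exact: mI.
have ig : P.-integrable setT (EFin \o (fun w => \1_A w - c : R)).
  apply: (@integrable_of_le _ _ _ _ _ (1 + `|c|)) => // w.
  by rewrite (le_trans (ler_normB _ _))// lerD2r indicE; case: (_ \in _); rewrite ?normr1 ?normr0.
have cg : condexp_zero P <<s S>> (fun w => \1_A w - c : R).
  split=> // E SE.
  have [D mD] : S E.
    apply: smallest_sub SE => //; apply: sigma_algebra_preimage.
    exact: sigma_algebra_measurable.
  rewrite setTI => EE.
  have mE : measurable E by rewrite -EE -[X in measurable X]setTI; exact: mxk.
  under eq_integral do rewrite EFinB.
  rewrite integralB_EFin//; last 2 first.
  - apply: integrableS (integrable_indic _ mA) => //.
  - exact: finite_measure_integrable_cst.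
  rewrite integral_indic// integral_cst//.
  have HI : P (A `&` E) = (P A * P E)%E by rewrite -EE; exact: (indep_past mx ind kn SA mD).
  transitivity (P (A `&` E) - P A * P E)%E; first by rewrite -cE.
  by rewrite HI subee// fin_numM// fin_num_measure.
have myS : measurable_wrt <<s S>> (fun w => x k w - mu).
  apply/measurable_wrtP; apply: measurable_funB => //.
  apply/measurable_wrtP => B mB; apply: sub_gen_smallest.
  by exists B => //; rewrite setTI.
have I0 : \int[P]_w (x k w - mu) = 0.
  have ix : P.-integrable setT (EFin \o x k).
    have -> : x k = (fun w => x k w - mu + mu) by apply/funext => w; rewrite subrK.
    exact: (integrableD measurableT iy (finite_measure_integrable_cst P mu measurableT)).
  rewrite RintegralB//; last exact: finite_measure_integrable_cst.
  by rewrite /Rintegral Ex integral_cst// [X in (_ * X)%E]probability_setT mule1 subrr.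
have i1 : P.-integrable setT (EFin \o (fun w => (x k w - mu) * \1_A w)).
  apply: integrableM_of_le xC _ => //; exact: integrable_indic.
have := condexp_zeroM Sm cg myS xC.
rewrite (@eq_Rintegral _ _ _ P setT (fun w => (x k w - mu) * \1_A w - c * (x k w - mu))); last first.
  by move=> w _; rewrite mulrBr [c * _]mulrC.
rewrite RintegralB//; last exact: (integrableZl measurableT c iy).
rewrite RintegralZl// I0 mulr0 subr0 (@eq_Rintegral _ _ _ P setT ((fun w => x k w - mu) \_ A)); last first.
  by move=> w _; rewrite indicE patchE; case: (_ \in _); rewrite ?mulr1 ?mulr0.
rewrite -Rintegral_mkcond /Rintegral => I1; rewrite -[LHS]fineK ?I1//.
by apply: integrable_fin_num => //; exact: (integrableS measurableT mA _ iy).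
Qed.

(** * Predictable intervals contain 0 almost surely; truncation of coefficients *)

Lemma condexp_zero_gt0_null (d : measure_display) (T : measurableType d) (R : realType)
  (P : probability T R) (S : set (set T)) (e : T -> R) (E : set T) :
  S `<=` measurable -> condexp_zero P <<s S>> e -> <<s S>> E ->
  (forall w, E w -> 0 < e w) -> P E = 0%E.
Proof.
move=> Sm [ie e0] SE epos.
have mE := g_sigma_algebra_sub Sm SE.
have me : measurable_fun E (EFin \o e).
  by case/integrableP: ie => + _; exact: measurable_funS.
have : (\int[P]_(w in E) `|(e w)%:E| = 0)%E.
  rewrite -[RHS](e0 E SE); apply: eq_integral => w; rewrite inE => Ew.
  by rewrite gee0_abs// lee_fin ltW// epos.
move/(ae_eq_integral_abs P mE me) => ae.
have : P.-negligible E.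
  apply: negligibleS ae => w Ew /= /(_ Ew) [ew].
  by have := epos w Ew; rewrite ew ltxx.
by move/measure_negligible => ->.
Qed.

Lemma condexp_zeroN (d : measure_display) (T : measurableType d) (R : realType)
  (P : probability T R) (S : set (set T)) (e : T -> R) :
  S `<=` measurable -> condexp_zero P <<s S>> e -> condexp_zero P <<s S>> (fun w => - e w).
Proof.
move=> Sm [ie e0]; split; first exact: integrableN ie.
move=> A SA; have mA := g_sigma_algebra_sub Sm SA.
under eq_integral do rewrite EFinN.
rewrite integralN ?e0 ?oppe0//.
exact/integrable_add_def/(integrableS measurableT mA _ ie).
Qed.

(** On the predictable event [a > 0] the centered [e] would be positive, and on [a < - 2u] negative;
    both events must be null. *)
Lemma predictable_itv_null (d : measure_display) (T : measurableType d) (R : realType)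
  (P : probability T R) (S : set (set T)) (e a : T -> R) (u : R) :
  S `<=` measurable -> condexp_zero P <<s S>> e -> measurable_wrt <<s S>> a ->
  (forall w, a w <= e w <= a w + 2 * u) ->
  exists A : set T, [/\ measurable A, P A = 0%E &
    forall w, ~ A w -> - (2 * u) <= a w <= 0].
Proof.
move=> Sm ce ma ae.
pose A1 := a @^-1` `]0, +oo[%classic.
pose A2 := a @^-1` `]-oo, - (2 * u)[%classic.
have S1 : <<s S>> A1 by exact: ma.
have S2 : <<s S>> A2 by exact: ma.
have m1 := g_sigma_algebra_sub Sm S1; have m2 := g_sigma_algebra_sub Sm S2.
exists (A1 `|` A2); split; first exact: measurableU.
  have P1 : P A1 = 0%E.
    apply: (condexp_zero_gt0_null Sm ce S1) => w.
    by rewrite /A1/= in_itv/= andbT; have /andP[? ?] := ae w; lra.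
  have P2 : P A2 = 0%E.
    apply: (condexp_zero_gt0_null Sm (condexp_zeroN Sm ce) S2) => w.
    by rewrite /A2/= in_itv/=; have /andP[? ?] := ae w; lra.
  apply/eqP; rewrite -measure_le0.
  apply: (@le_trans _ _ (P A1 + P A2)%E); first exact: measureU2.
  by rewrite P1 P2 adde0.
move=> w Aw; apply/andP; split; rewrite leNgt; apply/negP => h; apply: Aw.
  by right; rewrite /A2/= in_itv.
by left; rewrite /A1/= in_itv/= h.
Qed.

(* Truncating the coefficients yields an Azuma sum; the truncation is invisible *)
(* on the event where the coefficients are bounded by M. *)
Lemma azuma_truncated (d : measure_display) (T : measurableType d) (R : realType)
  (P : probability T R) (S : nat -> set (set T)) (c e a : nat -> T -> R)
  (u M lam : R) (m l n : nat) :
  0 <= u -> 0 <= M -> 0 < lam -> (0 < n)%N -> (l <= n)%N ->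
  (forall j, (m <= j < m + l)%N -> S j `<=` measurable) ->
  (forall i j, (i <= j)%N -> S i `<=` S j) ->
  (forall j, (m <= j < m + l)%N -> condexp_zero P <<s S j>> (e j)) ->
  (forall j, (m <= j < m + l)%N -> measurable_wrt <<s S j>> (c j)) ->
  (forall j, (m <= j < m + l)%N -> measurable_wrt <<s S j>> (a j)) ->
  (forall i j, (m <= i < j)%N -> measurable_wrt <<s S j>> (e i)) ->
  (forall j, (m <= j < m + l)%N -> forall w, a j w <= e j w <= a j w + 2 * u) ->
  exists A : set T, [/\ measurable A, (P A <= (2 * expR (- (lam ^+ 2 / 2)))%:E)%E &
    forall w, ~ A w -> (forall j, (m <= j < m + l)%N -> `|c j w| <= M) ->
      `|\sum_(m <= i < m + l) c i w * e i w| <= lam * Num.sqrt n%:R * u * M].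
Proof.
move=> u0 M0 lam0 n0 ln Sm Smon ce mc ma me ae.
(* The first indicator enforces the bound [M]; the second switches the term off where [[a, a + 2u]]
   misses 0, so that [azuma_zero] holds everywhere. *)
pose Y j w := c j w * (\1_(`[- M, M]%classic) (c j w) *
  \1_(`[- (2 * u), 0]%classic) (a j w)).
have mY i j : (m <= i < m + l)%N -> (i <= j)%N -> measurable_wrt <<s S j>> (Y i).
  move=> mi ij; apply/measurable_wrtP.
  have lift (f : T -> R) : measurable_wrt <<s S i>> f ->
      measurable_fun (setT : set (g_sigma_algebraType (S j))) f.
    move=> mf; apply/measurable_wrtP => B mB.
    exact: (sub_sigma_algebra2 (Smon _ _ ij)) (mf B mB).
  have mc' := lift _ (mc i mi); have ma' := lift _ (ma i mi).
  apply: measurable_funM => //; apply: measurable_funM.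
    by apply: measurableT_comp => //; exact: measurable_indic.
  by apply: measurableT_comp => //; exact: measurable_indic.
have H : azuma_sum P S Y e a u M m (m + l).
  split => //.
  - by move=> j mj; exact: mY.
  - move=> i j /andP[mi ij] jl; apply/measurable_wrtP; apply: measurable_funM.
      apply/measurable_wrtP; apply: mY (ltnW ij).
      by rewrite mi (leq_trans ij (ltnW jl)).
    by apply/measurable_wrtP; apply: me; rewrite mi.
  - move=> j mj w; rewrite /Y !indicE; case: (boolP (a j w \in _)).
      by rewrite inE/= in_itv.
    by rewrite !mulr0 eqxx.
  - move=> j mj w; rewrite /Y [\1__ (c j w)]indicE.
    case: (boolP (c j w \in _)); last by rewrite mul0r mulr0 normr0.
    rewrite inE/= in_itv/= -ler_norml mul1r normrM => cM.
    rewrite -[M]mulr1 ler_pM// indicE.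
    by case: in_mem; rewrite ?normr1 ?normr0.
have [A [mA PA HA]] := azuma_tail_norm u0 M0 lam0 n0 ln H.
(* The second indicator is 1 off the null sets [N i], so discarding their union costs no
   probability. *)
have /choice[N HN] : forall i : nat, exists N : set T, (i < l)%N ->
    [/\ measurable N, P N = 0%E & forall w, ~ N w -> - (2 * u) <= a (m + i)%N w <= 0].
  move=> i; case: (ltnP i l) => il; last by exists set0.
  have mj : (m <= m + i < m + l)%N by rewrite leq_addr ltn_add2l.
  have [N ?] := predictable_itv_null (Sm _ mj) (ce _ mj) (ma _ mj) (ae _ mj).
  by exists N.
pose U := \big[setU/set0]_(i < l) N i.
have mU : measurable U by apply: bigsetU_measurable => i _; have [] := HN i (ltn_ord i).
have U0 : P U = 0%E.
  apply/eqP; rewrite -measure_le0.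
  apply: (le_trans (@Boole_inequality _ _ _ P N l _)).
    by move=> i il; have [] := HN i il.
  by rewrite big1// => i _; have [] := HN i (ltn_ord i).
exists (A `|` U); split; first exact: measurableU.
  apply: (@le_trans _ _ (P A + P U)%E); first exact: measureU2.
  by rewrite U0 adde0.
move=> w AUw cM.
have Aw : ~ A w by move=> ?; apply: AUw; left.
have aw i : (i < l)%N -> - (2 * u) <= a (m + i)%N w <= 0.
  move=> il; have [_ _] := HN i il; apply => Nw; apply: AUw; right.
  by rewrite /U -(bigcup_mkord l N); exists i.
have := HA w Aw; congr (`| _ | <= _); apply: eq_big_nat => j mj.
rewrite /Y !indicE !mem_set ?mulr1//=.
  have /andP[m1 m2] := mj.
  by have := aw (j - m)%N; rewrite subnKC// in_itv/=; apply; rewrite ltn_subLR.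
by rewrite in_itv/= -ler_norml; exact: cM.
Qed.

(** * The summation error and its deterministic propagation *)

Lemma rsum_measurable (d : measure_display) (T : measurableType d) (R : realType)
  (x e : nat -> T -> R) (k : nat) :
  (forall i, (1 <= i <= k)%N -> measurable_fun setT (x i)) ->
  (forall i, (2 <= i <= k)%N -> measurable_fun setT (e i)) ->
  measurable_fun setT (rsum x e k).
Proof.
elim: k => [|k IH] mx me; first exact: measurable_cst.
rewrite /=; case: eqP => k0.
  by under eq_fun do []; apply: mx.
apply: measurable_funM; last first.
  apply: measurable_funD => //; apply: me.
  by rewrite ltnSn andbT ltnS lt0n; apply/eqP.
apply: measurable_funD; last by apply: mx; rewrite /= ltnSn.
by apply: IH => i ik; [apply: mx|apply: me]; case/andP: ik => -> /= /leqW.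
Qed.

Lemma rsum_error (T : Type) (R : realType) (x e : nat -> T -> R) (k : nat) (w : T) :
  (1 <= k)%N -> rsum x e k w - esum_n x k w =
  \sum_(2 <= j < k.+1) (rsum x e j.-1 w + x j w) * e j w.
Proof.
elim: k => // -[|k] IH _.
  by rewrite /esum_n big_nat1 big_geq//= subrr.
rewrite [RHS]big_nat_recr//= -IH// /esum_n [in LHS]big_nat_recr//=.
by ring.
Qed.

(** Strong induction on [k]: each coefficient equals [s_j + E_(j-1)], so it is at most
    [Q + B_(j-1)], and monotonicity of [B] makes [Q + B_(k-1)] a common bound. *)
Lemma rsum_error_le (T : Type) (R : realType) (x e : nat -> T -> R) (n : nat) (w : T)
  (Q : R) (B : nat -> R) :
  (forall j k, (1 <= j <= k)%N -> B j <= B k) -> 0 <= B 1%N ->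
  (forall j, (j <= n)%N -> `|esum_n x j w| <= Q) ->
  (forall k, (2 <= k <= n)%N ->
    (forall j, (2 <= j < k.+1)%N -> `|rsum x e j.-1 w + x j w| <= Q + B k.-1) ->
    `|\sum_(2 <= j < k.+1) (rsum x e j.-1 w + x j w) * e j w| <= B k) ->
  forall k, (1 <= k <= n)%N -> `|rsum x e k w - esum_n x k w| <= B k.
Proof.
move=> Bmon B1 sQ step; elim/ltn_ind => -[|[|k]] IH // k1n.
  by rewrite /= /esum_n big_nat1/= subrr normr0.
have kn : (k.+2 <= n)%N by case/andP: k1n.
rewrite [X in `|X|](_ : _ = \sum_(2 <= j < k.+3) (rsum x e j.-1 w + x j w) * e j w); last first.
  exact: (@rsum_error _ _ x e k.+2 w).
apply: step; first by rewrite kn.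
case=> [|[|j]] // /andP[_ jk].
have -> : rsum x e j.+2.-1 w + x j.+2 w =
    esum_n x j.+2 w + (rsum x e j.+1 w - esum_n x j.+1 w).
  by rewrite [esum_n x j.+2 w]/esum_n big_nat_recr//= -/(esum_n x j.+1 w); ring.
apply: (le_trans (ler_normD _ _)); apply: lerD.
  by apply: sQ; rewrite (leq_trans _ kn).
apply: (@le_trans _ _ (B j.+1)); last by apply: Bmon.
apply: IH => //; rewrite /=; rewrite !ltnS in jk.
by rewrite (leq_ltn_trans jk)// ltnW.
Qed.

(** [azuma_max] applies to [x i - mu] with unit coefficients and the constant interval [[- C, C]];
    the drift [j * mu] contributes at most [n * |mu|]. *)
Lemma indep_sum_le (d : measure_display) (T : measurableType d) (R : realType)
  (P : probability T R) (n : nat) (x : nat -> T -> R) (mu C lam : R) :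
  (0 < n)%N -> 0 < lam ->
  (forall i, (1 <= i <= n)%N -> measurable_fun setT (x i)) ->
  mutually_independent P x n ->
  (forall i, (1 <= i <= n)%N -> (\int[P]_w (x i w)%:E = mu%:E)%E) ->
  (forall i, (1 <= i <= n)%N -> forall w, `|x i w - mu| <= C) ->
  exists A : set T, [/\ measurable A, (P A <= (2 * expR (- (lam ^+ 2 / 2)))%:E)%E &
    forall w, ~ A w -> forall j, (j <= n)%N ->
      `|esum_n x j w| <= n%:R * `|mu| + lam * Num.sqrt n%:R * C].
Proof.
move=> n0 lam0 mx ind Ex xC.
have C0 : 0 <= C by apply: le_trans (xC 1%N _ point); rewrite ?n0.
pose S j := preims x [set i | (1 <= i < j)%N].
have r j : (1 <= j < 1 + n)%N -> (1 <= j <= n)%N by [].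
have H : azuma_sum P S (fun _ _ => 1) (fun j w => x j w - mu) (fun _ _ => - C) C 1 1 (1 + n).
  split.
  - move=> j /andP[_ jn]; apply: preims_measurable => i /andP[i1 ij]; apply: mx.
    by rewrite i1 -ltnS (leq_trans ij)// ltnW.
  - by move=> j /r j1n; apply: (indep_condexp_zero mx ind j1n (Ex j j1n)); exact: xC.
  - by move=> j _; apply/measurable_wrtP; exact: measurable_cst.
  - by move=> j _; apply/measurable_wrtP; exact: measurable_cst.
  - move=> i j ij _; apply/measurable_wrtP; under eq_fun do rewrite mul1r.
    apply: measurable_funB => //; apply/measurable_wrtP.
    exact: (measurable_wrt_preims (I := [set i | (1 <= i < j)%N])).
  - by move=> j /r j1n w; have := xC j j1n w; rewrite ler_norml => /andP[? ?]; apply/andP; split; lra.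
  - by move=> j _ w _; apply/andP; split; lra.
  - by move=> j _ w; rewrite normr1.
have [A [mA PA HA]] := azuma_max C0 ler01 lam0 n0 H.
exists A; split => // w /HA Aw j jn.
have -> : esum_n x j w = j%:R * mu + \sum_(1 <= i < 1 + j) 1 * (x i w - mu).
  under eq_bigr do rewrite mul1r.
  by rewrite sumrB sumr_const_nat add1n subn1 /= mulr_natl addrC subrK.
apply: (le_trans (ler_normD _ _)); apply: lerD; last first.
  by have := Aw j jn; rewrite mulr1.
by rewrite normrM normr_nat ler_wpM2r// ler_nat.
Qed.

(** * The recursion for the bounds and the union bound *)

Theorem theorem5p1 (dsp : measure_display) (T : measurableType dsp) (R : realType)
  (P : probability T R) (n : nat) (x dl a b : nat -> T -> R)
  (mu Cx u eps : R) :
  (2 <= n)%N -> 0 < u -> 0 < eps < 1 ->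
  (* x_1..x_n independent random variables with common mean mu, |x_i - mu| <= Cx *)
  (forall i, (1 <= i <= n)%N -> measurable_fun setT (x i)) ->
  mutually_independent P x n ->
  (forall i, (1 <= i <= n)%N -> (\int[P]_w (x i w)%:E = mu%:E)%E) ->
  (forall i, (1 <= i <= n)%N -> forall w, `|x i w - mu| <= Cx) ->
  (* rounding errors delta_2..delta_n *)
  (forall k, (2 <= k <= n)%N -> measurable_fun setT (dl k)) ->
  (forall k, (2 <= k <= n)%N -> (\int[P]_w (dl k w)%:E = 0)%E) ->
  (forall k, (2 <= k <= n)%N -> condexp_zero P (info x dl n k) (dl k)) ->
  (forall k, (2 <= k <= n)%N ->
     measurable_wrt (info x dl n k) (a k) /\ measurable_wrt (info x dl n k) (b k)) ->
  (forall k, (2 <= k <= n)%N -> forall w, a k w <= dl k w <= b k w) ->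
  (forall k, (2 <= k <= n)%N -> forall w, b k w - a k w <= 2 * u) ->
  let lam := Num.sqrt (2 * ln (2 * n%:R / eps)) in
  let kap := lam * Num.sqrt n%:R * u in
  ((1 - eps)%:E <=
   P [set w | (`|rsum x dl n w - esum_n x n w| <=
        (\sum_(0 <= j < n.-1) kap ^+ j) *
        (lam * `|mu| * (n%:R `^ (3%:R / 2%:R)) + lam ^+ 2 * Cx * n%:R) * u)%R])%E.
Proof.
move=> n2 u0 /andP[eps0 eps1] mx ind Ex xC md _ cd mab ab bau.
cbv zeta; set lam := Num.sqrt (2 * _); set kap := lam * _ * u.
have n0 : (0 < n)%N by rewrite (leq_trans _ n2).
have nR0 : 0 < n%:R :> R by rewrite ltr0n.
have C0 : 0 <= Cx by apply: le_trans (xC 1%N _ point); rewrite ?n0.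
have arg1 : 1 < 2 * n%:R / eps.
  have : 2 <= n%:R :> R by rewrite ler_nat.
  by rewrite ltr_pdivlMr// mul1r; lra.
have arg0 : 0 < 2 * n%:R / eps := lt_trans ltr01 arg1.
have lam2 : lam ^+ 2 = 2 * ln (2 * n%:R / eps).
  by rewrite sqr_sqrtr// mulr_ge0// ln_ge0// ltW.
have lam0 : 0 < lam by rewrite sqrtr_gt0 mulr_gt0// ln_gt0.
(* This is the purpose of [lam]: each two-sided tail costs exactly [eps / n]. *)
have tail : 2 * expR (- (lam ^+ 2 / 2)) = eps / n%:R.
  have -> : lam ^+ 2 / 2 = ln (2 * n%:R / eps) by rewrite lam2; lra.
  rewrite expRN lnK ?posrE//; field.
  by rewrite !gt_eqF.
have kap0 : 0 <= kap by rewrite !mulr_ge0 ?sqrtr_ge0// ltW.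
pose Q := n%:R * `|mu| + lam * Num.sqrt n%:R * Cx.
have Q0 : 0 <= Q by rewrite addr_ge0// !mulr_ge0 ?sqrtr_ge0// ltW.
(* The geometric sum has [k - 1] terms, so [B 1 = 0], matching the exact first step, and [B n] is
   the claimed bound. *)
pose B k := (\sum_(0 <= j < k.-1) kap ^+ j) *
  (lam * `|mu| * (n%:R `^ (3%:R / 2%:R)) + lam ^+ 2 * Cx * n%:R) * u.
have qE : (lam * `|mu| * (n%:R `^ (3%:R / 2%:R)) + lam ^+ 2 * Cx * n%:R) * u = kap * Q.
  have -> : n%:R `^ (3%:R / 2%:R) = n%:R * Num.sqrt n%:R :> R.
    have -> : 3%:R / 2%:R = 1 + 2^-1 :> R by lra.
    rewrite powRD ?powRr1 ?powR12_sqrt ?(ltW nR0)//.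
    by rewrite (gt_eqF nR0) implybT.
  by rewrite /kap /Q -{3}(sqr_sqrtr (ltW nR0)); ring.
have BE k : B k = (\sum_(0 <= j < k.-1) kap ^+ j) * (kap * Q).
  by rewrite /B -mulrA qE.
have B0 k : 0 <= B k.
  rewrite BE; apply: mulr_ge0; last exact: mulr_ge0.
  by apply: sumr_ge0 => i _; exact: exprn_ge0.
have Bmon j k : (1 <= j <= k)%N -> B j <= B k.
  move=> /andP[_ jk]; rewrite !BE; apply: ler_wpM2r; first exact: mulr_ge0.
  rewrite [leRHS](big_cat_nat (n := j.-1))//= -!subn1 ?leq_sub2r//.
  by rewrite lerDl sumr_ge0// => i _; rewrite exprn_ge0.
(* Horner's form of the geometric sum, [B k = kap * (Q + B (k - 1))], is the threshold that Azuma
   gives for coefficients bounded by [Q + B (k - 1)]. *)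
have BS k : (2 <= k)%N -> B k = lam * Num.sqrt n%:R * u * (Q + B k.-1).
  case: k => [|[|k]]// _; rewrite !BE /= big_nat_recl//= expr0.
  under eq_bigr do rewrite exprS.
  by rewrite -mulr_sumr -/kap; ring.
pose S k := preims x [set i | (1 <= i <= n)%N] `|` preims dl [set j | (2 <= j < k)%N].
have Sm k : (k <= n.+1)%N -> S k `<=` measurable.
  move=> kn; rewrite /S subUset; split; apply: preims_measurable => i; first exact: mx.
  by move=> /andP[i2 ik]; apply: md; rewrite i2 -ltnS (leq_trans ik).
have Smon i j : (i <= j)%N -> S i `<=` S j.
  move=> ij E [SE|[k [/andP[k2 ki] h]]]; [by left|right; exists k; split=> //].
  by rewrite /= k2 (leq_trans ki).
have xS i k : (1 <= i <= n)%N -> measurable_wrt <<s S k>> (x i).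
  by move=> i1n; apply: (measurable_wrt_preims i1n); exact: subsetUl.
have dS i k : (2 <= i < k)%N -> measurable_wrt <<s S k>> (dl i).
  by move=> ik; apply: (measurable_wrt_preims (I := [set j | (2 <= j < k)%N]) ik); exact: subsetUr.
have rS i k : (i < k)%N -> (i <= n)%N -> measurable_wrt <<s S k>> (rsum x dl i).
  move=> ik in'; apply/measurable_wrtP; apply: rsum_measurable => j /andP[j1 ji].
    by apply/measurable_wrtP; apply: xS; rewrite j1 (leq_trans ji).
  by apply/measurable_wrtP; apply: dS; rewrite j1 (leq_ltn_trans ji).
(* Index 0 controls all partial sums of the data, and index [k >= 1] controls the error at step
   [k + 1]; the indices below [n] thus cover steps 2 to [n]. *)
have ev k : exists A : set T, (k < n)%N -> [/\ measurable A,
    (P A <= (eps / n%:R)%:E)%E & forall w, ~ A w ->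
    if k == 0%N then forall j, (j <= n)%N -> `|esum_n x j w| <= Q else
    (forall j, (2 <= j < k.+2)%N -> `|rsum x dl j.-1 w + x j w| <= Q + B k) ->
    `|\sum_(2 <= j < k.+2) (rsum x dl j.-1 w + x j w) * dl j w| <= B k.+1].
  case: k => [|k].
    by have [A] := indep_sum_le n0 lam0 mx ind Ex xC; rewrite tail; exists A.
  case: (ltnP k.+1 n) => [kn|]; last by exists set0.
  have r j : (2 <= j < 2 + k.+1)%N -> (2 <= j <= n)%N.
    by move=> /andP[-> jk] /=; rewrite (leq_trans _ kn)// -ltnS.
  have mc j : (2 <= j < 2 + k.+1)%N ->
      measurable_wrt <<s S j>> (fun w => rsum x dl j.-1 w + x j w).
    move=> /r /andP[j2 jn]; apply/measurable_wrtP; apply: measurable_funD.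
      apply/measurable_wrtP; apply: rS; first by rewrite prednK// ltnW.
      exact: leq_trans (leq_pred _) jn.
    by apply/measurable_wrtP; apply: xS; rewrite jn ltnW.
  have ditv j : (2 <= j < 2 + k.+1)%N -> forall w, a j w <= dl j w <= a j w + 2 * u.
    move=> /r j2n w; have /andP[-> ?] := ab j j2n w.
    by have := bau j j2n w; lra.
  have [A [mA PA HA]] := azuma_truncated (ltW u0) (addr_ge0 Q0 (B0 k.+1)) lam0 n0 (ltnW kn)
    (fun j j2 => Sm j (leqW (proj2 (andP (r j j2))))) Smon (fun j j2 => cd j (r j j2))
    mc (fun j j2 => proj1 (mab j (r j j2))) dS ditv.
  exists A; split=> //; first by rewrite -tail.
  by move=> w /HA Aw cM; rewrite BS//; exact: Aw.
have [A HA] := choice ev.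
pose U := \big[setU/set0]_(k < n) A k.
have mU : measurable U by apply: bigsetU_measurable => k _; have [] := HA k (ltn_ord k).
have PU : (P U <= eps%:E)%E.
  apply: (le_trans (@Boole_inequality _ _ _ P A n _)).
    by move=> k kn; have [] := HA k kn.
  apply: (@le_trans _ _ (\sum_(k < n) (eps / n%:R)%:E)%E).
    by apply: lee_sum => k _; have [] := HA k (ltn_ord k).
  by rewrite sumEFin sumr_const card_ord -[(eps / _) *+ _]mulr_natr divfK ?gt_eqF.
set G := [set w | _].
have mG : measurable G.
  have mr := measurable_wrtW (Sm _ (leqnn _)) (rS n n.+1 (ltnSn n) (leqnn n)).
  have ms : measurable_fun setT (esum_n x n).
    apply: (measurable_wrtW (Sm _ (leqnn _))).
    by apply: measurable_wrt_sum => i; rewrite ltnS; exact: xS.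
  rewrite (_ : G = (fun w => `|rsum x dl n w - esum_n x n w|) @^-1` `]-oo, B n]%classic).
    rewrite -[X in measurable X]setTI.
    by apply: measurableT_comp (measurable_itv _) => //; exact: measurable_funB.
  by apply/seteqP; split => w /=; rewrite in_itv.
have UG : ~` U `<=` G.
  move=> w Uw.
  have nA k : (k < n)%N -> ~ A k w.
    by move=> kn Ak; apply: Uw; rewrite /U -(bigcup_mkord n A); exists k.
  have [_ _ /(_ _ (nA _ n0)) /= sQ] := HA 0%N n0.
  apply: (rsum_error_le (n := n) Bmon (B0 1%N) sQ) => [[|[|k]]//= kn cM|]; last by rewrite n0 /=.
  by have [_ _ /(_ _ (nA _ kn)) /=] := HA k.+1 kn; apply.
apply: (@le_trans _ _ (P (~` U))); last by apply: le_measure; rewrite ?inE//; exact: measurableC.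
by rewrite probability_setC// EFinB leeB.
Qed.
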